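(* Consider an infinite server queue with stationary batch arrival rate $\lambda>0$, fixed arrival batch size $n\in\mathbb{Z}^+$, and exponential service rate $\mu>0$. In steady-state, the number in system $Q_\infty(n)$ satisfies $$Q_\infty(n)\stackrel{D}{=}\sum_{j=1}^n jY_j,$$ where $Y_1,\dots,Y_n$ are independent with $Y_j\sim\mathrm{Pois}\left(\frac{\lambda}{j\mu}\right)$.
   Context: Model: batches of exactly $n$ customers arrive at the epochs of a Poisson process of rate $\lambda$. There are infinitely many servers, so each customer starts service immediately and leaves after an independent $\mathrm{Exp}(\mu)$ service time. The number in system $Q_t(n)$ is thus the continuous-time Markov chain on $\{0,1,2,\dots\}$ with transitions $q\to q+n$ at rate $\lambda$ and $q\to q-1$ at rate $\mu q$. $Q_\infty(n)$ has the limiting distribution of $Q_t(n)$ as $t\to\infty$. *)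

(* Defs.v *)
From HB Require Import structures.
From mathcomp Require Import all_boot all_order all_algebra.
From mathcomp Require Import all_classical all_reals all_analysis.

Set Implicit Arguments.
Unset Strict Implicit.
Unset Printing Implicit Defensive.

Import Order.TTheory GRing.Theory Num.Theory.
Import numFieldNormedType.Exports.

Local Open Scope classical_set_scope.
Local Open Scope ring_scope.

(* Honest stochastic semigroup (p t) on nat, with p t i j the probability of
   moving from i to j in time t; the values at negative times are irrelevant. *)
Definition transition_function (R : realType) (p : R -> nat -> nat -> R) :=
  [/\ forall (t : R) i j, 0 <= t -> 0 <= p t i j,
      forall (t : R) i, 0 <= t -> (\sum_(0 <= j <oo) (p t i j)%:E = 1)%E,
      forall i j, p 0 i j = (i == j)%:R
    & forall (s t : R) i k, 0 <= s -> 0 <= t ->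
        (\sum_(0 <= j <oo) (p s i j * p t j k)%:E = (p (s + t) i k)%:E)%E].

(* p h i j = (i == j) + q i j * h + o(h) as h decreases to 0. *)
Definition has_generator (R : realType) (p : R -> nat -> nat -> R)
    (q : nat -> nat -> R) :=
  forall i j, (p h i j - (i == j)%:R) / h @[h --> 0^'+] --> q i j.

(* Conditioning on X_(s 0) = x 0, ..., X_(s m) = x m is written in product
   form, so that nothing has to be said about null events. *)
Definition markov_with (R : realType) (d : measure_display)
    (T : measurableType d) (P : probability T R) (X : R -> {RV P >-> nat})
    (p : R -> nat -> nat -> R) :=
  forall (m : nat) (s : nat -> R) (x : nat -> nat),
    0 <= s 0%N -> (forall k, (k <= m)%N -> s k < s k.+1) ->
    P [set w | forall k, (k <= m.+1)%N -> X (s k) w = x k] =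
    (P [set w | forall k, (k <= m)%N -> X (s k) w = x k] *
     (p (s m.+1 - s m) (x m) (x m.+1))%:E)%E.

(* (X_t)_(t >= 0) is a time-homogeneous continuous-time Markov chain with
   generator q, started from an arbitrary initial distribution. *)
Definition ctmc (R : realType) (d : measure_display) (T : measurableType d)
    (P : probability T R) (q : nat -> nat -> R) (X : R -> {RV P >-> nat}) :=
  exists p : R -> nat -> nat -> R,
    [/\ transition_function p, has_generator p q & markov_with X p].

(* The first two cases are disjoint, and distinct from the diagonal, when
   0 < n. *)
Definition batch_queue_generator (R : realType) (lambda mu : R) (n : nat)
    (i j : nat) : R :=
  if j == (i + n)%N then lambda
  else if j.+1 == i then mu * i%:R
  else if j == i then - (lambda + mu * i%:R)
  else 0.

(* Pointwise convergence to a probability measure on nat, which is the same as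
   convergence in distribution. *)
Definition limiting_distribution (R : realType) (d : measure_display)
    (T : measurableType d) (P : probability T R) (X : R -> {RV P >-> nat})
    (nu : probability nat R) :=
  forall k : nat, P (X t @^-1` [set k]) @[t --> +oo%R] --> nu [set k].

Definition mutually_independent (R : realType) (d : measure_display)
    (T : measurableType d) (P : probability T R) (I : finType)
    (Y : I -> {RV P >-> nat}) :=
  forall A : I -> set nat,
    P [set w | forall i, A i (Y i w)] = (\prod_i P (Y i @^-1` A i))%E.

(* As in poisson_pmf, r is meant to be positive. *)
Definition poisson_distributed (R : realType) (d : measure_display)
    (T : measurableType d) (P : probability T R) (Y : {RV P >-> nat}) (r : R) :=
  forall k : nat, P (Y @^-1` [set k]) = (poisson_pmf r k)%:E.

Definition eq_in_distribution (R : realType) (d d' : measure_display)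
    (T : measurableType d) (T' : measurableType d') (P : probability T R)
    (P' : probability T' R) (X : T -> nat) (X' : T' -> nat) :=
  forall A : set nat, P (X @^-1` A) = P' (X' @^-1` A).

(* Main.v *)
Require Import Defs.
From HB Require Import structures.
From mathcomp Require Import all_boot all_order all_algebra.
From mathcomp Require Import all_classical all_reals all_analysis.
From mathcomp Require Import measurable_realfun.
From mathcomp Require Import ring lra zify.

Set Implicit Arguments.
Unset Strict Implicit.
Unset Printing Implicit Defensive.

Import Order.TTheory GRing.Theory Num.Theory.
Import numFieldNormedType.Exports.

Local Open Scope classical_set_scope.
Local Open Scope ring_scope.

(** Fix z in (0, 1) and start the queue with i customers.  Thinning suggests the
    value of the generating function E[z ^ Q_t]: with
    w(t) = 1 - (1 - z) e^(- mu t), each initial customer contributes a factor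
    w(t) (it is still present at time t with probability e^(- mu t)), and the
    Poisson stream of batches contributes
    exp (- lambda \int_0^t (1 - w(s) ^ n) ds).  As w' = mu (1 - w) and
    (1 - v ^ n) / (1 - v) is the derivative of
    H(v) = \sum_(1 <= j <= n) v ^ j / j, that exponent is
    (lambda / mu) (H(z) - H(w(t))).  When t grows, w(t) tends to 1, so whatever
    the initial law
    E[z ^ Q_t] --> exp ((lambda / mu) (H(z) - H(1)))
    = \prod_(1 <= j <= n) exp (lambda / (j mu) (z ^ j - 1)),
    and the right-hand side is the generating function of \sum_j j Y_j.

    The chain is only known through the derivatives at 0 of its transition
    functions, so the formula for E[z ^ Q_t] is proved analytically.  As the rows
    of the generator are finite and sum to 0, functions with values in [0, 1]
    have the expected infinitesimal drift ([generator_cvg]); by the semigroup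
    property u(t, i) = E_i[z ^ Q_t] then solves the backward equation, with
    derivatives from the right.  The closed form g(t, i) solves it as well
    ([is_derive_transient_pgf]).  Bounded solutions are unique because the
    upward drift of the function i |-> i + 1 is at most lambda n, which excludes
    explosion: this is a maximum principle ([drift_comparison]), applied to
    u - g and to g - u in [transition_pgf].

    The passage from generating functions back to probabilities is an elementary
    continuity theorem ([cvg_of_pgf]); the generating function of \sum_j j Y_j
    is a product of expectations by [integral_prod_independent].  Since the
    law of \sum_j j Y_j is thus a limiting distribution, and limits are unique,
    both claims follow. *)

(** * Averages against a probability vector *)

Definition prob_vector (R : realType) (a : nat -> R) :=
  (forall j, 0 <= a j) /\ (\sum_(0 <= j <oo) (a j)%:E = 1)%E.

(** The series is summed in the extended reals, where nonnegative terms can be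
    rearranged freely; its value is finite when a is a probability
    vector and f is nonnegative and bounded. *)
Definition mean (R : realType) (a f : nat -> R) : R :=
  fine (\sum_(0 <= j <oo) (a j * f j)%:E)%E.

Section Mean.
Context {R : realType}.
Implicit Types (a f : nat -> R).

Lemma prob_vector_psum_le1 a N : prob_vector a -> \sum_(0 <= j < N) a j <= 1.
Proof.
move=> [a0 a1]; rewrite -lee_fin -sumEFin -a1.
by apply: nneseries_lim_ge => j _ _; rewrite lee_fin.
Qed.

Lemma prob_vector_psum_gt a (e : R) : prob_vector a -> 0 < e ->
  exists N, 1 - e < \sum_(0 <= j < N) a j.
Proof.
move=> [a0 a1] e0.
have cv : (\sum_(0 <= j < N) (a j)%:E)%E @[N --> \oo] --> 1%E.
  rewrite -a1; apply: is_cvg_nneseries => j _ _; by rewrite lee_fin.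
have {}cv : (\sum_(0 <= j < N) a j) @[N --> \oo] --> (1 : R).
  have := fine_cvg cv; rewrite /comp; under eq_fun do rewrite sumEFin /=; exact.
have /cvgrPdist_lt /(_ e e0) [N _ /(_ N (leqnn N)) /= H] := cv.
by exists N; move: H; rewrite ltr_norml; lra.
Qed.

Lemma meanE a f : prob_vector a -> (forall j, 0 <= f j <= 1) ->
  (mean a f)%:E = (\sum_(0 <= j <oo) (a j * f j)%:E)%E.
Proof.
move=> [a0 a1] f01; rewrite /mean fineK// ge0_fin_numE; last first.
  apply: nneseries_ge0 => j _ _; rewrite lee_fin mulr_ge0//.
  by case/andP: (f01 j).
apply: (@le_lt_trans _ _ 1%E); last exact: ltry.
rewrite -a1; apply: lee_nneseries => j _; rewrite lee_fin.
  by move=> _; rewrite mulr_ge0//; case/andP: (f01 j).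
by rewrite ler_piMr//; case/andP: (f01 j).
Qed.

Lemma mean_ge_psum a f N : prob_vector a -> (forall j, 0 <= f j <= 1) ->
  \sum_(0 <= j < N) a j * f j <= mean a f.
Proof.
move=> pa f01; rewrite -lee_fin meanE// -sumEFin.
apply: nneseries_lim_ge => j _ _; rewrite lee_fin mulr_ge0//; first exact: pa.1.
by case/andP: (f01 j).
Qed.

(** The mass that a puts beyond N is 1 minus the partial sum, and f is at most c
    there. *)
Lemma mean_le_psum a f N (c : R) : prob_vector a ->
  (forall j, 0 <= f j <= 1) -> (forall j, (N <= j)%N -> f j <= c) ->
  mean a f <= \sum_(0 <= j < N) a j * f j + c * (1 - \sum_(0 <= j < N) a j).
Proof.
move=> pa f01 fc; have [a0 a1] := pa.
have f0 j : 0 <= f j by case/andP: (f01 j).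
rewrite -lee_fin meanE// (@nneseries_split _ _ 0%N N) ?add0n; last first.
  by move=> j _; rewrite lee_fin mulr_ge0.
rewrite EFinD -sumEFin leeD2l// EFinM.
have -> : ((1 - \sum_(0 <= j < N) a j)%:E = \sum_(N <= j <oo) (a j)%:E)%E.
  move: a1; rewrite (@nneseries_split _ _ 0%N N) ?add0n//; last first.
    by move=> j _; rewrite lee_fin.
  rewrite sumEFin => S1; rewrite EFinB.
  transitivity (1 - (\sum_(0 <= j < N) a j)%:E)%E => //.
  by rewrite -S1 addeAC subee// add0e.
rewrite -nneseriesZl; last by move=> j _; rewrite lee_fin.
rewrite -(@nneseries_addn _ (fun j => (a j * f j)%:E)); last first.
  by move=> j; rewrite lee_fin mulr_ge0.
rewrite -(@nneseries_addn _ (fun j => c%:E * (a j)%:E)%E); last first.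
  move=> j; rewrite -EFinM lee_fin mulr_ge0//.
  exact: le_trans (f0 N) (fc _ _).
apply: lee_nneseries => j _; first by rewrite lee_fin mulr_ge0.
by rewrite -EFinM lee_fin mulrC ler_wpM2r// fc// leq_addl.
Qed.

Lemma mean_ge0 a f : prob_vector a -> (forall j, 0 <= f j <= 1) ->
  0 <= mean a f.
Proof.
by move=> pa f01; have := mean_ge_psum 0 pa f01; rewrite big_geq.
Qed.

Lemma mean_le1 a f : prob_vector a -> (forall j, 0 <= f j <= 1) ->
  mean a f <= 1.
Proof.
move=> pa f01.
have := @mean_le_psum a f 0 1 pa f01 (fun j _ => proj2 (andP (f01 j))).
by rewrite !big_geq// subr0 mulr1 add0r.
Qed.

Lemma meanZ a f (c : R) : prob_vector a -> (forall j, 0 <= f j <= 1) ->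
  mean a (fun j => c * f j) = c * mean a f.
Proof.
move=> pa f01; rewrite -[RHS]/(fine (c * mean a f)%:E) EFinM meanE//.
rewrite -nneseriesZl.
  by congr fine; apply: eq_eseriesr => j _; rewrite -EFinM mulrCA.
by move=> j _; rewrite lee_fin mulr_ge0//; [exact: pa.1|case/andP: (f01 j)].
Qed.

(** Tonelli: averaging against a mixture of the rows of p can be done row by
    row.  This serves both for the semigroup property and for the random initial
    state. *)
Lemma mean_mix (a b : nat -> R) (p : nat -> nat -> R) f :
  prob_vector a -> (forall j, prob_vector (p j)) ->
  (forall k, (\sum_(0 <= j <oo) (a j * p j k)%:E)%E = (b k)%:E) ->
  (forall k, 0 <= f k <= 1) ->
  mean b f = mean a (fun j => mean (p j) f).
Proof.
move=> pa pp abp f01; have f0 k : 0 <= f k by case/andP: (f01 k).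
rewrite /mean; congr fine.
transitivity (\sum_(0 <= k <oo) \sum_(0 <= j <oo) (a j * p j k * f k)%:E)%E.
  apply: eq_eseriesr => k _; rewrite mulrC EFinM -abp -nneseriesZl.
    by apply: eq_eseriesr => j _; rewrite -EFinM mulrC.
  by move=> j _; rewrite lee_fin mulr_ge0//; [exact: pa.1|exact: (pp j).1].
rewrite nneseries_interchange; last first.
  by move=> k j; rewrite lee_fin !mulr_ge0//; [exact: pa.1|exact: (pp j).1].
apply: eq_eseriesr => j _; rewrite EFinM -/(mean _ _) meanE// -nneseriesZl.
  by apply: eq_eseriesr => k _; rewrite -EFinM mulrA.
by move=> k _; rewrite lee_fin mulr_ge0//; exact: (pp j).1.
Qed.

End Mean.

(** Only the mass 1 - a i away from i can move the average away from f i. *)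
Lemma mean_dist_atom (R : realType) (a f : nat -> R) i : prob_vector a ->
  (forall j, 0 <= f j <= 1) -> `|mean a f - f i| <= 1 - a i.
Proof.
move=> pa f01; have a0 := pa.1.
have S0 : 0 <= \sum_(0 <= j < i) a j * f j.
  by rewrite sumr_ge0// => j _; rewrite mulr_ge0//; case/andP: (f01 j).
have S1 : \sum_(0 <= j < i) a j * f j <= \sum_(0 <= j < i) a j.
  by rewrite ler_sum// => j _; rewrite ler_piMr//; case/andP: (f01 j).
have := mean_ge_psum i.+1 pa f01; have := prob_vector_psum_le1 i.+1 pa.
have := @mean_le_psum _ _ _ i.+1 1 pa f01 (fun j _ => proj2 (andP (f01 j))).
rewrite !big_nat_recr//= ler_norml.
have : 0 <= (1 - a i) * f i.
  rewrite mulr_ge0//; last by case/andP: (f01 i).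
  have := prob_vector_psum_le1 i.+1 pa; rewrite big_nat_recr//=.
  have : 0 <= \sum_(0 <= j < i) a j by rewrite sumr_ge0.
  lra.
have : 0 <= (1 - a i) * (1 - f i).
  rewrite mulr_ge0//; last by case/andP: (f01 i); rewrite subr_ge0.
  have := prob_vector_psum_le1 i.+1 pa; rewrite big_nat_recr//=.
  have : 0 <= \sum_(0 <= j < i) a j by rewrite sumr_ge0.
  lra.
lra.
Qed.

(** * Generating functions and limits of probability vectors *)

Lemma cvg_sum_nat (R : realType) (T : Type) (F : set_system T) (FF : Filter F)
    (N : nat) (f : nat -> T -> R) (l : nat -> R) :
  (forall k, (k < N)%N -> f k x @[x --> F] --> l k) ->
  \sum_(0 <= k < N) f k x @[x --> F] --> \sum_(0 <= k < N) l k.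
Proof.
elim: N => [|N IH] H.
  by rewrite big_geq//; under eq_fun do rewrite big_geq//; exact: cvg_cst.
rewrite big_nat_recr//=; under eq_fun do rewrite big_nat_recr//=.
by apply: cvgD; [apply: IH => k kN; apply: H; exact: ltnW|exact: H].
Qed.

(** Beyond rank k, the powers of z are at most z ^+ k.+1. *)
Lemma pgf_bounds (R : realType) (a : nat -> R) (z : R) k : prob_vector a ->
  0 <= z <= 1 ->
  0 <= mean a (fun j => z ^+ j) - \sum_(0 <= j < k) a j * z ^+ j - a k * z ^+ k
    <= z ^+ k.+1.
Proof.
move=> pa z01; have f01 j : 0 <= z ^+ j <= 1.
  by case/andP: z01 => z0 z1; rewrite exprn_ge0//= exprn_ile1.
have := mean_ge_psum k.+1 pa f01.
have := @mean_le_psum R a (fun j => z ^+ j) k.+1 (z ^+ k.+1) pa f01.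
rewrite !big_nat_recr//= => /(_ _)/wrap[|].
  move=> j kj; rewrite -(subnK kj) addnC exprD ler_piMr//.
    by case/andP: (f01 k.+1).
  by case/andP: (f01 (j - k.+1)%N).
have : 0 <= z ^+ k.+1 * (\sum_(0 <= i < k) a i + a k).
  rewrite mulr_ge0//; first by case/andP: (f01 k.+1).
  by rewrite addr_ge0 ?sumr_ge0//; [move=> i _|]; exact: pa.1.
lra.
Qed.

(** Continuity theorem for generating functions.  By strong induction on k, the
    terms of rank less than k may be subtracted; after division by z ^+ k the
    generating functions determine a t k and b k up to an error z, and z is
    as small as desired. *)
Lemma cvg_of_pgf (R : realType) (T : Type) (F : set_system T)
    (FF : Filter F) (a : T -> nat -> R) (b : nat -> R) :
  (forall t, prob_vector (a t)) -> prob_vector b ->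
  (forall z, 0 < z < 1 ->
    mean (a t) (fun j => z ^+ j) @[t --> F] --> mean b (fun j => z ^+ j)) ->
  forall k, a t k @[t --> F] --> b k.
Proof.
move=> pa pb ab k; elim/ltn_ind: k => k IH.
apply/cvgrPdist_le => e e0.
(* any z in (0, 1) with 2 * z <= e would do *)
pose z := e / (e + 2).
have z01 : 0 < z < 1.
  by rewrite divr_gt0 ?addr_gt0//= ltr_pdivrMr ?addr_gt0// mul1r ltrDl.
have ze : 2 * z <= e.
  rewrite /z mulrCA ler_piMr ?(ltW e0)// ler_pdivrMr ?addr_gt0//.
  by rewrite mul1r lerDr ltW.
have z01' : 0 <= z <= 1 by case/andP: z01 => /ltW -> /ltW ->.
have zk0 : 0 < z ^+ k by rewrite exprn_gt0//; case/andP: z01.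
have zk10 : 0 < z ^+ k.+1 by rewrite exprn_gt0//; case/andP: z01.
have cS : mean (a t) (fun j => z ^+ j) - \sum_(0 <= j < k) a t j * z ^+ j
    @[t --> F] --> mean b (fun j => z ^+ j) - \sum_(0 <= j < k) b j * z ^+ j.
  apply: cvgB; first exact: ab.
  by apply: cvg_sum_nat => j jk; apply: cvgMr_tmp; exact: IH.
move/cvgrPdist_lt : cS => /(_ _ zk10); apply: filterS => t.
have := pgf_bounds k (pa t) z01'; have := pgf_bounds k pb z01'.
rewrite ltr_norml => Hb Ha H.
have : `|(b k - a t k) * z ^+ k| <= 2 * z ^+ k.+1.
  by rewrite ler_norml mulrBl; move: Ha Hb H; lra.
rewrite normrM (gtr0_norm zk0) exprS mulrA ler_pM2r// => /le_trans; exact.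
Qed.

(** Dominated convergence, in the form needed to forget the initial state: a
    finite partial sum already carries a mass close to 1, and on it the powers
    of w t tend to 1. *)
Lemma mean_exp_cvg1 (R : realType) (T : Type) (F : set_system T)
    (FF : Filter F) (a : nat -> R) (w : T -> R) : prob_vector a ->
  (\forall t \near F, 0 <= w t <= 1) -> w t @[t --> F] --> (1 : R) ->
  mean a (fun k => w t ^+ k) @[t --> F] --> (1 : R).
Proof.
move=> pa w01 cw; apply/cvgrPdist_lt => e e0.
have [N HN] := prob_vector_psum_gt pa e0.
have cS : \sum_(0 <= k < N) a k * w t ^+ k @[t --> F] -->
    \sum_(0 <= k < N) a k * 1.
  apply: cvg_sum_nat => k _; apply: cvgMl_tmp.
  rewrite -[X in _ --> X](expr1n _ k).
  exact: (cvg_comp _ _ cw (@exprn_continuous R k 1)).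
have H := cvgr_gt _ cS (1 - e).
near=> t; have wt : 0 <= w t <= 1 by near: t.
have f01 k : 0 <= w t ^+ k <= 1.
  by case/andP: wt => ? ?; rewrite exprn_ge0//= exprn_ile1.
have : 1 - e < \sum_(0 <= k < N) a k * w t ^+ k.
  near: t; apply: H; rewrite (eq_bigr a)// => k _; exact: mulr1.
have := mean_ge_psum N pa f01; have := mean_le1 pa f01.
by rewrite ltr_norml; lra.
Unshelve. all: by end_near. Qed.

(** * Infinitesimal action of the generator *)

(** A conservative row supported in [0, N) acts on all bounded functions, not
    only on finitely supported ones: the mass that p h i puts outside [0, N) is
    1 minus a finite sum, hence o(h) because the row sums to 0. *)
Lemma generator_cvg (R : realType) (p : R -> nat -> nat -> R)
    (q : nat -> nat -> R) (i N : nat) (f : nat -> R) :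
  (forall h, 0 <= h -> prob_vector (p h i)) ->
  has_generator p q -> (i < N)%N -> \sum_(0 <= k < N) q i k = 0 ->
  (forall j, 0 <= f j <= 1) ->
  (mean (p h i) f - f i) / h @[h --> 0^'+] --> \sum_(0 <= k < N) q i k * f k.
Proof.
move=> pp pq iN q0 f01.
pose L h := \sum_(0 <= k < N) (p h i k - (i == k)%:R) / h * f k.
pose E h := \sum_(0 <= k < N) (p h i k - (i == k)%:R) / h.
have cL : L h @[h --> 0^'+] --> \sum_(0 <= k < N) q i k * f k.
  by apply: cvg_sum_nat => k _; apply: cvgMr_tmp; exact: pq.
have cE : E h @[h --> 0^'+] --> (0 : R).
  by rewrite -[X in _ --> X]q0; apply: cvg_sum_nat => k _; exact: pq.
have sdelta (g : nat -> R) : \sum_(0 <= k < N) (i == k)%:R * g k = g i.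
  rewrite (bigD1_seq i)/= ?iota_uniq ?mem_index_iota//= eqxx mul1r.
  by rewrite big1 ?addr0// => k; rewrite eq_sym => /negbTE ->; rewrite mul0r.
apply: (@squeeze_cvgr _ _ _ _ L (fun h => L h - E h)) => //; last first.
  by rewrite -[X in _ --> X]subr0; exact: cvgB.
near=> h; have h0 : 0 < h by near: h; exact: nbhs_right_gt.
have -> : L h = (\sum_(0 <= k < N) p h i k * f k - f i) / h.
  rewrite -(sdelta f) -sumrB mulr_suml; apply: eq_bigr => k _.
  by rewrite -mulrBl mulrAC.
have -> : E h = (\sum_(0 <= k < N) p h i k - 1) / h.
  rewrite -(sdelta (fun=> 1)) -sumrB mulr_suml; apply: eq_bigr => k _.
  by rewrite mulr1.
have ph := pp _ (ltW h0).
rewrite -mulrBl !ler_pM2r ?invr_gt0// lerD2r mean_ge_psum//=.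
have := @mean_le_psum _ _ _ N 1 ph f01 (fun j _ => proj2 (andP (f01 j))).
lra.
Unshelve. all: by end_near. Qed.

(** There is no state below i = 0, but the coefficient of f i.-1 vanishes there. *)
Definition batch_drift (R : realType) (lambda mu : R) (n : nat)
    (f : nat -> R) (i : nat) : R :=
  lambda * (f (i + n)%N - f i) + mu * i%:R * (f i.-1 - f i).

Lemma batch_queue_generatorE (R : realType) (lambda mu : R) (n : nat)
    (f : nat -> R) (i : nat) : (0 < n)%N ->
  \sum_(0 <= k < (i + n).+1) batch_queue_generator lambda mu n i k * f k =
  batch_drift lambda mu n f i.
Proof.
move=> n0.
have pick m (c : R) : (m < (i + n).+1)%N ->
    \sum_(0 <= k < (i + n).+1) (k == m)%:R * (c * f k) = c * f m.
  move=> mN; rewrite (bigD1_seq m) ?iota_uniq ?mem_index_iota//= eqxx mul1r.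
  by rewrite big1 ?addr0// => k /negbTE ->; rewrite mul0r.
transitivity (\sum_(0 <= k < (i + n).+1)
  ((k == i + n)%:R * (lambda * f k) + (k == i.-1)%:R * (mu * i%:R * f k) +
   (k == i)%:R * (- (lambda + mu * i%:R) * f k))).
  apply: eq_bigr => k _; rewrite /batch_queue_generator.
  have [->|kin] := eqVneq k (i + n)%N.
    have -> : (i + n == i.-1)%N = false by apply/negbTE; lia.
    have -> : (i + n == i)%N = false by apply/negbTE; lia.
    by rewrite /=; ring.
  have [ki|ki] := eqVneq k.+1 i.
    by rewrite -ki /= eqxx (ltn_eqF (ltnSn k)) /=; ring.
  have [->|_] := eqVneq k i; last first.
    case: i ki {kin pick} => [|i] ki /=; first by ring.
    by rewrite -eqSS (negbTE ki) /=; ring.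
  by case: i {ki kin pick} => [|i] /=; rewrite ?(gtn_eqF (ltnSn i)) /=; ring.
rewrite !big_split/= !pick ?leq_addr//; last first.
- by rewrite ltnS (leq_trans (leq_pred i))// leq_addr.
by rewrite /batch_drift; ring.
Qed.

(** * A maximum principle for the backward equation *)

(** Induction along the half-line; a property that holds up to the supremum of
    its initial segments can be pushed beyond it. *)
Lemma real_induction (R : realType) (S : R -> Prop) : S 0 ->
  (forall t, 0 <= t -> S t -> \forall h \near 0^'+, S (t + h)) ->
  (forall t, 0 < t -> (forall s, 0 <= s < t -> S s) -> S t) ->
  forall t, 0 <= t -> S t.
Proof.
move=> S0 Sr Sl t t0; apply: contrapT => nSt.
pose A := [set r : R | 0 <= r /\ forall s, 0 <= s <= r -> S s].
have A0 : A 0 by split=> // s s0; have -> : s = 0 by lra.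
have At : ubound A t.
  move=> r [r0 rS]; rewrite leNgt; apply/negP => tr; apply: nSt.
  by apply: rS; rewrite t0 ltW.
have supA : has_sup A by split; [exists 0|exists t].
set m := sup A.
have m0 : 0 <= m by apply: ub_le_sup => //; exists t.
have Slt s : 0 <= s < m -> S s.
  move=> /andP[s0 sm]; have sm' : 0 < m - s by rewrite subr_gt0.
  have [r [_ rS]] := sup_adherent sm' supA.
  by rewrite -/m => mr; apply: rS; rewrite s0/=; lra.
have Sm : S m.
  by move: m0; rewrite le_eqVlt => /predU1P[<-//|m0]; exact: Sl.
have [e /= e0 He] := Sr m m0 Sm.
have : A (m + e / 2).
  split=> [|s /andP[s0 sme]]; first by rewrite addr_ge0// divr_ge0// ltW.
  have [sm|] := ltP s m; first by apply: Slt; rewrite s0.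
  rewrite le_eqVlt => /predU1P[<-//|ms].
  rewrite -(subrKC m s); apply: He; last by rewrite /= subr_gt0.
  by rewrite /= sub0r normrN gtr0_norm ?subr_gt0//; move: e0 sme; lra.
by move/(ub_le_sup (ex_intro _ t At)); rewrite -/m; move: e0; lra.
Qed.

(** If f t < 0, the existence of the right slope makes f continuous from the
    right and keeps it negative; if f t = 0, the negative slope does. *)
Lemma right_slope_le0 (R : realType) (f : R -> R) (t l : R) :
  (f (t + h) - f t) / h @[h --> 0^'+] --> l ->
  f t <= 0 -> (f t = 0 -> l < 0) ->
  \forall h \near 0^'+, f (t + h) <= 0.
Proof.
move=> fl; rewrite le_eqVlt => /predU1P[ft0 /(_ ft0) l0|ft0 _].
  have := cvgr_lt _ fl 0 l0; rewrite ft0 => H; near=> h.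
  have h0 : 0 < h by near: h; exact: nbhs_right_gt.
  have : (f (t + h) - 0) / h < 0 by near: h; exact: H.
  by rewrite subr0 ltr_pdivrMr// mul0r => /ltW.
have l1 : l < l + 1 by rewrite ltrDl.
have H := cvgr_lt _ fl _ l1.
near=> h; have h0 : 0 < h by near: h; exact: nbhs_right_gt.
have : (f (t + h) - f t) / h < l + 1 by near: h; exact: H.
rewrite ltr_pdivrMr// => Hh.
have : h < - f t / (`|l| + 1).
  by near: h; apply: nbhs_right_lt; rewrite divr_gt0 ?oppr_gt0// ltr_wpDl.
rewrite ltr_pdivlMr ?ltr_wpDl// => Hh2.
have : (l + 1) * h <= h * (`|l| + 1).
  by rewrite mulrC ler_pM2l// lerD2r ler_norm.
by move: Hh Hh2; lra.
Unshelve. all: by end_near. Qed.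

(** Maximum principle.  The barrier e * (i + 1 + c t), with c > lambda n, is a
    strict supersolution of the backward equation: its drift in i is
    e (lambda n - mu i), less than its time derivative e c.  It dominates the
    bounded function v for large i, so only finitely many states matter, and at
    a first contact in one of these v would have to cross the barrier with a
    slope smaller than that of the barrier.  Letting e tend to 0 gives v <= 0. *)
Lemma drift_comparison (R : realType) (lambda mu : R) (n : nat)
    (v : R -> nat -> R) (B : R) :
  0 < lambda -> 0 < mu ->
  (forall t i, 0 <= t -> v t i <= B) ->
  (forall i, v 0 i <= 0) ->
  (forall t i, 0 < t -> v (t - h) i @[h --> 0^'+] --> v t i) ->
  (forall t i, 0 <= t -> (v (t + h) i - v t i) / h @[h --> 0^'+] -->
     batch_drift lambda mu n (v t) i) ->
  forall t i, 0 <= t -> v t i <= 0.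
Proof.
move=> la0 mu0 vB v0 vl vr t i t0.
pose c := lambda * n%:R + 1.
have c0 : 0 < c by rewrite ltr_wpDl// mulr_ge0// ltW.
suff main e : 0 < e -> forall r, 0 <= r ->
    forall j, v r j - e * (j%:R + 1 + c * r) <= 0.
  apply/ler_addgt0Pl => e e0.
  have K0 : 0 < i%:R + 1 + c * t by rewrite ltr_wpDr ?ltr_wpDl// mulr_ge0// ltW.
  have := main (e / (i%:R + 1 + c * t)) (divr_gt0 e0 K0) t t0 i.
  by rewrite divfK ?gt_eqF// subr_le0 addr0.
move=> e0; apply: real_induction.
- move=> j; rewrite mulr0 addr0 subr_le0 (le_trans (v0 j))//.
  by rewrite mulr_ge0 ?ltW// ltr_wpDl.
- move=> r r0 IH.
  (* from the state M on, the barrier exceeds the bound B *)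
  pose M := Num.trunc (B / e).
  have far j s : 0 <= s -> (M <= j)%N -> v s j - e * (j%:R + 1 + c * s) <= 0.
    move=> s0 Mj; rewrite subr_le0 (le_trans (vB _ _ s0))//.
    rewrite -ler_pdivrMl// mulrC.
    have := truncnS_gt (B / e). rewrite -/M => H.
    have : (M.+1%:R : R) <= j.+1%:R by rewrite ler_nat ltnS.
    have : 0 <= c * s by rewrite mulr_ge0// ltW.
    by rewrite -natr1; move: e0; lra.
  have near_j (j : 'I_M) : \forall h \near 0^'+,
      v (r + h) j - e * (j%:R + 1 + c * (r + h)) <= 0.
    pose w s := v s j - e * (j%:R + 1 + c * s).
    apply: (@right_slope_le0 _ w r
      (batch_drift lambda mu n (v r) j - e * c)) => [||].
    + apply: (@cvg_trans _ ((v (r + h) j - v r j) / h - e * c @[h --> 0^'+])).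
        apply: near_eq_cvg; near=> h.
        have h0 : h != 0 by rewrite gt_eqF//; near: h; exact: nbhs_right_gt.
        by rewrite /w; field.
      by apply: cvgB; [exact: vr|exact: cvg_cst].
    + exact: IH.
    + rewrite /w => /eqP; rewrite subr_eq0 => /eqP wj.
      rewrite /batch_drift wj.
      have H1 := IH (j + n)%N; have H2 := IH j.-1.
      have : lambda * (v r (j + n)%N - e * (j%:R + 1 + c * r)) <=
             lambda * (e * n%:R).
        by rewrite ler_pM2l//; move: H1; rewrite natrD; lra.
      have : mu * j%:R * (v r j.-1 - e * (j%:R + 1 + c * r)) <= 0.
        rewrite mulr_ge0_le0 ?mulr_ge0// ?(ltW mu0)//.
        apply: le_trans H2; rewrite lerD2l lerN2 ler_pM2l//.
        by rewrite !lerD2r ler_nat leq_pred.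
      by rewrite /c; move: e0; lra.
  near=> h => j; have h0 : 0 < h by near: h; exact: nbhs_right_gt.
  have [Mj|jM] := leqP M j; first by apply: far => //; rewrite addr_ge0// ltW.
  have : forall k : 'I_M, v (r + h) k - e * (k%:R + 1 + c * (r + h)) <= 0.
    by near: h; exact: filter_forall.
  by move/(_ (Ordinal jM)).
- move=> r r0 IH j.
  have cv : v (r - h) j - e * (j%:R + 1 + c * (r - h)) @[h --> 0^'+] -->
      v r j - e * (j%:R + 1 + c * (r - 0)).
    apply: cvgB; first exact: vl.
    apply: cvgMl_tmp; apply: cvgD; first exact: cvg_cst.
    apply: cvgMl_tmp; apply: cvgB; first exact: cvg_cst.
    by apply: cvg_at_right_filter; exact: cvg_id.
  rewrite subr0 in cv.
  apply: (cvgr_to_le cv); near=> h; apply: IH.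
  have : 0 < h by near: h; exact: nbhs_right_gt.
  have : h < r by near: h; exact: nbhs_right_lt.
  lra.
Unshelve. all: by end_near. Qed.

(** * The explicit solution of the backward equation *)

(** A primitive of (1 - v ^ n) / (1 - v). *)
Definition harmonic_poly (R : realType) (n : nat) : {poly R} :=
  \sum_(j < n) j.+1%:R^-1 *: 'X^(j.+1).

Lemma harmonic_polyE (R : realType) n (v : R) :
  (harmonic_poly R n).[v] = \sum_(j < n) v ^+ j.+1 / j.+1%:R.
Proof.
by rewrite horner_sum; apply: eq_bigr => j _; rewrite hornerZ hornerXn mulrC.
Qed.

Lemma deriv_harmonic_poly (R : realType) n (v : R) :
  (1 - v) * (harmonic_poly R n)^`().[v] = 1 - v ^+ n.
Proof.
rewrite -[1 - v]opprB -[RHS]opprB subrX1 mulNr; congr (- (_ * _)).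
rewrite raddf_sum horner_sum; apply: eq_bigr => j _ /=.
rewrite derivZ derivXn hornerZ hornerMn hornerXn -[_ ^+ _ *+ _]mulr_natl.
by rewrite mulKf// pnatr_eq0.
Qed.

(** E[z ^ B], where B indicates that a customer present at time 0 is still in
    service at time t. *)
Definition survival_pgf (R : realType) (mu z t : R) : R :=
  1 - (1 - z) * expR (- (mu * t)).

(** E[z ^ Q_t] for the queue started with i customers. *)
Definition transient_pgf (R : realType) (lambda mu : R) (n : nat) (z t : R)
    (i : nat) : R :=
  expR (lambda / mu *
    ((harmonic_poly R n).[z] - (harmonic_poly R n).[survival_pgf mu z t])) *
  survival_pgf mu z t ^+ i.

Section TransientPgf.
Context {R : realType} (lambda mu : R) (n : nat) (z : R).
Hypotheses (la0 : 0 < lambda) (mu0 : 0 < mu) (z01 : 0 < z < 1).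

Let w := survival_pgf mu z.
Let H := harmonic_poly R n.
Let g := transient_pgf lambda mu n z.

Lemma survival_pgf_itv t : 0 <= t -> z <= w t <= 1.
Proof.
move=> t0; rewrite /w /survival_pgf.
have e0 := expR_gt0 (- (mu * t)).
have e1 : expR (- (mu * t)) <= 1.
  by rewrite -(@expR0 R) ler_expR oppr_le0 mulr_ge0// ltW.
have z1 : 0 <= 1 - z by case/andP: z01 => _ /ltW; rewrite subr_ge0.
have : 0 <= (1 - z) * expR (- (mu * t)) by rewrite mulr_ge0// ltW.
have : (1 - z) * expR (- (mu * t)) <= 1 - z by rewrite ler_piMr.
lra.
Qed.

Lemma transient_pgf_itv t i : 0 <= t -> 0 <= g t i <= 1.
Proof.
move=> t0; have /andP[zw w1] := survival_pgf_itv t0.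
have z0 : 0 <= z by case/andP: z01 => /ltW.
have w0 : 0 <= w t by lra.
rewrite /g /transient_pgf mulr_ge0 ?expR_ge0 ?exprn_ge0//=.
rewrite mulr_ile1 ?expR_ge0 ?exprn_ge0// ?exprn_ile1//.
rewrite -[leRHS]expR0 ler_expR; apply: mulr_ge0_le0.
  by rewrite divr_ge0// ltW.
rewrite subr_le0 !harmonic_polyE ler_sum// => j _.
by rewrite ler_pM2r ?invr_gt0// lerXn2r.
Qed.

Lemma is_derive_survival_pgf t : is_derive t (1 : R) w (mu * (1 - w t)).
Proof.
rewrite /w /survival_pgf.
have E1 : is_derive t (1 : R) (fun s => - (mu * s)) (- mu).
  apply: is_derive_eq.
  by rewrite /= ?scaler0 ?addr0 ?add0r /GRing.scale/= ?mulr1.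
have E2 := @is_derive1_comp R expR (fun s => - (mu * s)) t _ _
  (is_derive_expR _) E1.
have E3 := is_deriveB (is_derive_cst (1 : R) t 1) (is_deriveZ (1 - z) E2).
apply: (is_derive_eq E3); rewrite /= /GRing.scale/= sub0r; ring.
Qed.

(** With w' = mu (1 - w), the exponential factor has logarithmic derivative
    - lambda (1 - w ^ n), which is the contribution of the arrivals, and w ^ i
    yields the contribution of the departures. *)
Lemma is_derive_transient_pgf t i :
  is_derive t (1 : R) (g ^~ i) (batch_drift lambda mu n (g t) i).
Proof.
have dw := is_derive_survival_pgf t.
have dH := @is_derive1_comp R (horner H) w t _ _ (is_derive_poly H _) dw.
have dE := @is_derive1_comp R expR _ t _ _ (is_derive_expR _)
  (is_deriveZ (lambda / mu) (is_deriveB (is_derive_cst H.[z] t 1) dH)).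
have -> : g ^~ i = (expR \o (lambda / mu *: (cst H.[z] - (horner H \o w)))) *
    w ^+ i.
  by apply/funext => s; rewrite /g /transient_pgf !fctE.
apply: (is_derive_eq (is_deriveM dE (is_deriveX i dw))).
have Hw := deriv_harmonic_poly n (w t).
rewrite /batch_drift /g /transient_pgf -/(w t) /= /GRing.scale/= sub0r.
have -> : expR (lambda / mu * (cst H.[z] - (horner H \o w)) t) =
  expR (lambda / mu * (H.[z] - H.[w t])) by [].
have -> : (w ^+ i) t = w t ^+ i by rewrite exprfctE.
rewrite -/H; set E := expR _.
have Hw' : lambda * (w t ^+ n - 1) =
    lambda / mu * - (H^`().[w t] * (mu * (1 - w t))).
  by rewrite -[w t ^+ n - 1]opprB -Hw; field; exact: lt0r_neq0.
(* for i = 0 the exponent i.-1 is harmless because of the factor i *)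
rewrite -Hw' exprD; case: i => [|i] /=; first by ring.
by rewrite (exprS _ i); ring.
Qed.

Lemma right_slope_transient_pgf t i :
  (g (t + h) i - g t i) / h @[h --> 0^'+] --> batch_drift lambda mu n (g t) i.
Proof.
have [dg <-] := is_derive_transient_pgf t i.
have cd : h^-1 *: (g (h *: 1 + t) i - g t i) @[h --> 0^'] --> 'D_1 (g ^~ i) t.
  exact: dg.
apply: cvg_dnbhs_at_right; apply: cvg_trans cd; apply: near_eq_cvg.
by near=> h; rewrite /GRing.scale/= mulr1 mulrC (addrC h).
Unshelve. all: by end_near. Qed.

Lemma left_cvg_transient_pgf t i :
  g (t - h) i @[h --> 0^'+] --> g t i.
Proof.
have /derivable1_diffP/differentiable_continuous gc :=
   @ex_derive _ _ _ _ _ _ _ (is_derive_transient_pgf t i).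
have th : t - h @[h --> 0] --> t.
  by rewrite -[X in _ --> X]subr0; apply: cvgB; [exact: cvg_cst|exact: cvg_id].
by apply: cvg_at_right_filter; exact: (cvg_comp _ _ th gc).
Qed.

End TransientPgf.

Lemma cvg_survival_pgf (R : realType) (mu z : R) : 0 < mu ->
  survival_pgf mu z t @[t --> +oo] --> (1 : R).
Proof.
move=> mu0; rewrite -[X in _ --> X]subr0 -[X in _ - X](mulr0 (1 - z)).
apply: cvgB; first exact: cvg_cst.
apply: cvgMl_tmp.
have mut : mu * t @[t --> +oo%R] --> +oo.
  by apply: gt0_cvgMry => //; exact: cvg_id.
exact: (cvg_comp _ _ mut (@cvgr_expR R)).
Qed.

(** * Transition probabilities of the queue *)

Section Transition.
Context {R : realType} (lambda mu : R) (n : nat) (p : R -> nat -> nat -> R).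
Hypotheses (la0 : 0 < lambda) (mu0 : 0 < mu) (n0 : (0 < n)%N).
Hypotheses (tp : transition_function p)
  (gp : has_generator p (batch_queue_generator lambda mu n)).

Lemma transition_prob_vector t i : 0 <= t -> prob_vector (p t i).
Proof.
by move=> t0; case: tp => p0 p1 _ _; split=> [j|]; [exact: p0|exact: p1].
Qed.

Lemma mean_semigroup s t i f : 0 <= s -> 0 <= t -> (forall k, 0 <= f k <= 1) ->
  mean (p (s + t) i) f = mean (p s i) (fun j => mean (p t j) f).
Proof.
move=> s0 t0 f01; case: tp => _ _ _ ck; apply: mean_mix => //.
- exact: transition_prob_vector.
- by move=> j; exact: transition_prob_vector.
- by move=> k; exact: ck.
Qed.

Lemma batch_drift_cvg i f : (forall k, 0 <= f k <= 1) ->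
  (mean (p h i) f - f i) / h @[h --> 0^'+] --> batch_drift lambda mu n f i.
Proof.
move=> f01; rewrite -batch_queue_generatorE//; apply: generator_cvg => //.
- by move=> h; exact: transition_prob_vector.
- by rewrite ltnS leq_addr.
- have := batch_queue_generatorE lambda mu (fun=> 1) i n0.
  under eq_bigr do rewrite mulr1.
  by rewrite /batch_drift !subrr !mulr0 addr0.
Qed.

(** The chain leaves i at a finite rate; this is what makes the transition
    functions continuous in time. *)
Lemma right_cvg_transition_diag i : 1 - p h i i @[h --> 0^'+] --> (0 : R).
Proof.
have H : h * ((p h i i - (i == i)%:R) / h) @[h --> 0^'+] -->
    0 * batch_queue_generator lambda mu n i i.
  by apply: cvgM; [apply: cvg_at_right_filter; exact: cvg_id|exact: gp].
rewrite mul0r eqxx in H; rewrite -[X in _ --> X]oppr0.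
apply: cvg_trans (cvgN H); apply: near_eq_cvg; near=> h.
have h0 : h != 0 by rewrite gt_eqF//; near: h; exact: nbhs_right_gt.
by rewrite !fctE mulrCA divff// mulr1 opprB.
Unshelve. all: by end_near. Qed.

(** Both sides solve the backward equation with initial value z ^+ i and take
    values in [0, 1], so the maximum principle applies to their difference with
    either sign. *)
Lemma transition_pgf z t i : 0 < z < 1 -> 0 <= t ->
  mean (p t i) (fun k => z ^+ k) = transient_pgf lambda mu n z t i.
Proof.
move=> z01 t0; have z01' k : 0 <= z ^+ k <= 1.
  by case/andP: z01 => /ltW z0 /ltW z1; rewrite exprn_ge0//= exprn_ile1.
pose u t i := mean (p t i) (fun k => z ^+ k).
pose g := transient_pgf lambda mu n z.
have u01 s j : 0 <= s -> 0 <= u s j <= 1.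
  by move=> s0; rewrite mean_ge0 ?mean_le1//; exact: transition_prob_vector.
have g01 s j : 0 <= s -> 0 <= g s j <= 1 by exact: transient_pgf_itv.
have ug0 j : u 0 j = g 0 j.
  have -> : g 0 j = z ^+ j.
    by rewrite /g /transient_pgf /survival_pgf mulr0 oppr0 expR0 mulr1 subKr
      subrr mulr0 expR0 mul1r.
  apply/eqP; rewrite -subr_eq0 -normr_le0.
  have := @mean_dist_atom _ _ _ j (transition_prob_vector j (lexx 0)) z01'.
  by case: tp => _ _ -> _; rewrite eqxx subrr.
(* continuity from the left: u s j is the average of u (s - h) over a step of
   length h from j, during which the chain hardly moves *)
have ul s j : 0 < s -> u (s - h) j @[h --> 0^'+] --> u s j.
  move=> s0; apply/cvgrPdist_le => e e0.
  have /cvgrPdist_le /(_ e e0) H := right_cvg_transition_diag j.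
  near=> h; have h0 : 0 < h by near: h; exact: nbhs_right_gt.
  have hs : h < s by near: h; exact: nbhs_right_lt.
  have sh0 : 0 <= s - h by rewrite subr_ge0 ltW.
  have -> : u s j = mean (p h j) (u (s - h)).
    by rewrite /u -[X in p X j](subrKC h s) mean_semigroup// ltW.
  apply: le_trans (@mean_dist_atom _ (p h j) (u (s - h)) j _ _) _.
  - exact: transition_prob_vector (ltW _).
  - by move=> k; exact: u01.
  - apply: le_trans (ler_norm _) _; rewrite -normrN -[- _]sub0r.
    by near: h; exact: H.
have ur s j : 0 <= s ->
    (u (s + h) j - u s j) / h @[h --> 0^'+] --> batch_drift lambda mu n (u s) j.
  move=> s0; have H := @batch_drift_cvg j (u s) (fun k => u01 s k s0).
  apply: cvg_trans H; apply: near_eq_cvg; near=> h.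
  have h0 : 0 < h by near: h; exact: nbhs_right_gt.
  by rewrite /u [s + h]addrC mean_semigroup// ltW.
have gl s j : g (s - h) j @[h --> 0^'+] --> g s j.
  exact: left_cvg_transient_pgf.
have gr s j : (g (s + h) j - g s j) / h @[h --> 0^'+] -->
    batch_drift lambda mu n (g s) j.
  exact: right_slope_transient_pgf.
have sub_slope (v1 v2 : R -> nat -> R) s j :
    (v1 (s + h) j - v1 s j) / h @[h --> 0^'+] -->
      batch_drift lambda mu n (v1 s) j ->
    (v2 (s + h) j - v2 s j) / h @[h --> 0^'+] -->
      batch_drift lambda mu n (v2 s) j ->
    (v1 (s + h) j - v2 (s + h) j - (v1 s j - v2 s j)) / h @[h --> 0^'+] -->
      batch_drift lambda mu n (fun k => v1 s k - v2 s k) j.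
  move=> c1 c2.
  have -> : batch_drift lambda mu n (fun k => v1 s k - v2 s k) j =
      batch_drift lambda mu n (v1 s) j - batch_drift lambda mu n (v2 s) j.
    by rewrite /batch_drift; ring.
  apply: cvg_trans (cvgB c1 c2); apply: near_eq_cvg; near=> h.
  by rewrite !fctE -mulrBl; congr (_ / _); ring.
apply/eqP; rewrite eq_le -[X in X && _]subr_le0 -[X in _ && X]subr_le0.
apply/andP; split.
- apply: (@drift_comparison _ lambda mu n (fun t i => u t i - g t i) 1) => //.
  + by move=> s j s0; have := u01 s j s0; have := g01 s j s0; lra.
  + by move=> j; rewrite ug0 subrr.
  + by move=> s j s0; apply: cvgB; [exact: ul|exact: gl].
  + by move=> s j s0; apply: sub_slope; [exact: ur|exact: gr].
- apply: (@drift_comparison _ lambda mu n (fun t i => g t i - u t i) 1) => //.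
  + by move=> s j s0; have := u01 s j s0; have := g01 s j s0; lra.
  + by move=> j; rewrite ug0 subrr.
  + by move=> s j s0; apply: cvgB; [exact: gl|exact: ul].
  + by move=> s j s0; apply: sub_slope; [exact: gr|exact: ur].
Unshelve. all: by end_near. Qed.

End Transition.

(** * Laws and independence of random variables with values in nat *)

Section NatLaw.
Context {R : realType} {d : measure_display} {T : measurableType d}
  (P : probability T R).

Definition nat_law (X : T -> nat) (k : nat) : R := fine (P (X @^-1` [set k])).

Lemma measurable_nat_preimage (X : {RV P >-> nat}) (A : set nat) :
  measurable (X @^-1` A).
Proof. by rewrite -[_ @^-1` _]setTI; exact: measurable_funP. Qed.

Lemma nat_lawE (X : {RV P >-> nat}) k :
  (nat_law X k)%:E = P (X @^-1` [set k]).
Proof.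
by rewrite /nat_law fineK// fin_num_measure//; exact: measurable_nat_preimage.
Qed.

Lemma bigcup_fibres (X : T -> nat) (D : set T) :
  \bigcup_k (D `&` X @^-1` [set k]) = D.
Proof.
by apply/seteqP; split=> [w [k _ []]//|w Dw]; exists (X w).
Qed.

Lemma trivIset_fibres (X : T -> nat) (D : set T) :
  trivIset setT (fun k => D `&` X @^-1` [set k]).
Proof.
by move=> i j _ _ [w [[_ /= <-] [_ /= <-]]].
Qed.

Lemma measurable_fibre (X : {RV P >-> nat}) (D : set T) k :
  measurable D -> measurable (D `&` X @^-1` [set k]).
Proof.
by move=> mD; apply: measurableI => //; exact: measurable_nat_preimage.
Qed.

Lemma total_probability (X : {RV P >-> nat}) (D : set T) : measurable D ->
  P D = (\sum_(0 <= k <oo) P (D `&` X @^-1` [set k]))%E.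
Proof.
move=> mD; rewrite -measure_semi_bigcup ?bigcup_fibres//.
- by move=> k; exact: measurable_fibre.
- exact: trivIset_fibres.
Qed.

Lemma nat_law_prob_vector (X : {RV P >-> nat}) : prob_vector (nat_law X).
Proof.
split=> [k|]; first exact: fine_ge0.
under eq_eseriesr do rewrite nat_lawE -[X in P X]setTI.
by rewrite -total_probability// probability_setT.
Qed.

Lemma ge0_integral_nat_fibres (X : {RV P >-> nat}) (D : set T)
    (f : T -> \bar R) : measurable D -> measurable_fun D f ->
  (forall w, D w -> 0 <= f w)%E ->
  (\int[P]_(w in D) f w =
   \sum_(0 <= k <oo) \int[P]_(w in D `&` X @^-1` [set k]) f w)%E.
Proof.
move=> mD mf f0.
rewrite -{1}(bigcup_fibres X D) ge0_integral_bigcup ?bigcup_fibres//.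
- by move=> k; exact: measurable_fibre.
- exact: trivIset_fibres.
Qed.

Lemma measurable_nat_comp (X : {RV P >-> nat}) (f : nat -> R) (D : set T) :
  measurable_fun D (fun w => f (X w)).
Proof.
apply: measurable_funTS.
by apply: (measurableT_comp (f := f) (g := X)).
Qed.

Lemma mean_nat_law (X : {RV P >-> nat}) (f : nat -> R) :
  (forall k, 0 <= f k <= 1) ->
  ((mean (nat_law X) f)%:E = \int[P]_w (f (X w))%:E)%E.
Proof.
move=> f01; rewrite (ge0_integral_nat_fibres X)//; first last.
- by move=> w _; rewrite lee_fin; case/andP: (f01 (X w)).
- by apply/measurable_EFinP; exact: measurable_nat_comp.
rewrite meanE//; last exact: nat_law_prob_vector.
apply: eq_eseriesr => k _; rewrite setTI.
rewrite (eq_integral (cst (f k)%:E)).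
  rewrite integral_cst ?EFinM ?nat_lawE 1?muleC//.
  exact: measurable_nat_preimage.
by move=> w; rewrite inE /= => ->.
Qed.

End NatLaw.

Section Independence.
Context {R : realType} {d : measure_display} {T : measurableType d}
  (P : probability T R) (I : finType) (Y : I -> {RV P >-> nat}).

Lemma measurable_box (A : I -> set nat) :
  measurable [set w | forall i, A i (Y i w)].
Proof.
have -> : [set w | forall i, A i (Y i w)] =
    \bigcap_(i in [set: I]) (Y i @^-1` A i).
  by apply/seteqP; split=> [w H i _|w H i]; exact: H.
apply: fin_bigcap_measurable => // i _; exact: measurable_nat_preimage.
Qed.

(** Independence is a product rule for events, and the factors F i (Y i) are put
    in one at a time.  For the induction, the coordinates outside l are kept as
    events A i; to add i to l, the domain is cut along the values k of Y i, which
    turns A i into the singleton k and makes F i (Y i) constant. *)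
Lemma integral_prod_independent (F : I -> nat -> R) (l : seq I)
    (A : I -> set nat) :
  mutually_independent Y -> (forall i k, 0 <= F i k <= 1) -> uniq l ->
  (forall i, i \in l -> A i = setT) ->
  (\int[P]_(w in [set w | forall i, A i (Y i w)])
      (\prod_(i <- l) F i (Y i w))%:E =
   (\prod_i (if i \in l then mean (nat_law P (Y i)) (F i)
             else fine (P (Y i @^-1` A i))))%:E)%E.
Proof.
move=> indep F01; have F0 i k : 0 <= F i k by case/andP: (F01 i k).
have mprod l' D : measurable_fun D (fun w => (\prod_(i <- l') F i (Y i w))%:E).
  apply/measurable_EFinP; apply: measurable_prod => i _.
  exact: measurable_nat_comp.
have prod0 l' w : (0 <= (\prod_(i <- l') F i (Y i w))%:E)%E.
  by rewrite lee_fin prodr_ge0.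
elim: l A => [A _ _|i l IH A /= /andP[il ul] AT].
  rewrite (eq_integral (cst 1%E)); last by move=> w _; rewrite big_nil.
  rewrite integral_cst; last exact: measurable_box.
  rewrite mul1e; apply: (etrans (indep A)); rewrite -prodEFin.
  apply: eq_bigr => i _.
  by rewrite fineK// fin_num_measure//; exact: measurable_nat_preimage.
rewrite (ge0_integral_nat_fibres (Y i))//; last exact: measurable_box.
pose A' k j := if j == i then [set k] else A j.
pose C := \prod_(j | j != i) (if j \in l then mean (nat_law P (Y j)) (F j)
  else fine (P (Y j @^-1` A j))).
transitivity (\sum_(0 <= k <oo) (C%:E * (nat_law P (Y i) k * F i k)%:E))%E.
  apply: eq_eseriesr => k _.
  have -> : [set w | forall j, A j (Y j w)] `&` Y i @^-1` [set k] =
      [set w | forall j, A' k j (Y j w)].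
    apply/seteqP; split=> w /= => [[Aw Yw] j|A'w].
      by rewrite /A'; case: eqP => [->|_]; [exact: Yw|exact: Aw].
    split=> [j|]; last by have := A'w i; rewrite /A' eqxx.
    have := A'w j; rewrite /A'; case: eqP => // -> _.
    by rewrite AT// mem_head.
  rewrite (eq_integral
    (fun w => (F i k)%:E * (\prod_(j <- l) F j (Y j w))%:E)%E); last first.
    move=> w; rewrite inE /= => /(_ i); rewrite /A' eqxx => /= Yw.
    by rewrite big_cons Yw EFinM.
  rewrite ge0_integralZl_EFin//; last exact: measurable_box.
  rewrite IH//; last first.
    move=> j jl; rewrite /A'; case: eqP => [ji|_].
      by move: il; rewrite -ji jl.
    by apply: AT; rewrite inE jl orbT.
  rewrite (bigD1 i)//= (negbTE il) /A' eqxx -!EFinM; congr (_%:E).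
  rewrite mulrCA [RHS]mulrC -mulrA; congr (_ * _).
  congr (_ * _).
  by apply: eq_bigr => j /negbTE ->.
rewrite nneseriesZl; last first.
  by move=> k _; rewrite lee_fin mulr_ge0// (nat_law_prob_vector (Y i)).1.
rewrite -meanE//; last exact: nat_law_prob_vector.
rewrite -EFinM mulrC [in RHS](bigD1 i)//= mem_head; congr (_ * _)%:E.
by apply: eq_bigr => j /negbTE ji; rewrite inE ji.
Qed.

Lemma integral_prod_independentT (F : I -> nat -> R) :
  mutually_independent Y -> (forall i k, 0 <= F i k <= 1) ->
  (\int[P]_w (\prod_i F i (Y i w))%:E =
   (\prod_i mean (nat_law P (Y i)) (F i))%:E)%E.
Proof.
move=> indep F01.
have := @integral_prod_independent F (index_enum I) (fun=> setT) indep F01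
  (index_enum_uniq I) (fun _ _ => erefl).
have -> : [set w | forall i, [set: nat] (Y i w)] = setT by apply/seteqP; split.
by under [in RHS]eq_bigr do rewrite mem_index_enum.
Qed.

End Independence.

Lemma eq_distribution_of_nat_law (R : realType) (d d' : measure_display)
    (T : measurableType d) (T' : measurableType d') (P : probability T R)
    (P' : probability T' R) (X : {RV P >-> nat}) (X' : {RV P' >-> nat}) :
  nat_law P X =1 nat_law P' X' -> eq_in_distribution P P' X X'.
Proof.
have fibreE (d0 : measure_display) (T0 : measurableType d0)
    (P0 : probability T0 R) (X0 : {RV P0 >-> nat}) (A : set nat) k :
    P0 (X0 @^-1` A `&` X0 @^-1` [set k]) =
    if k \in A then (nat_law P0 X0 k)%:E else 0%E.
  rewrite -preimage_setI setI1; case: ifP => kA.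
    by rewrite nat_lawE.
  by rewrite preimage_set0 measure0.
move=> PX A; rewrite (total_probability X (measurable_nat_preimage X A)).
rewrite (total_probability X' (measurable_nat_preimage X' A)).
by apply: eq_eseriesr => k _; rewrite !fibreE PX.
Qed.

(** * Weighted sums of independent Poisson variables *)

Lemma poisson_pgf (R : realType) (a : nat -> R) (r y : R) : 0 < r ->
  0 <= y <= 1 -> (forall k, a k = poisson_pmf r k) ->
  mean a (fun k => y ^+ k) = expR (r * (y - 1)).
Proof.
move=> r0 /andP[y0 y1] ak.
rewrite /mean; apply: EFin_inj.
under eq_eseriesr => k _.
  rewrite ak /poisson_pmf r0 [_ * expR _]mulrC -mulrA [_ / _ * _]mulrAC.
  rewrite -exprMn EFinM. over.
rewrite nneseriesZl; last first.
  by move=> k _; rewrite lee_fin divr_ge0// exprn_ge0// mulr_ge0// ltW.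
have -> : (\sum_(0 <= k <oo) ((r * y) ^+ k / k`!%:R)%:E = (expR (r * y))%:E)%E.
  rewrite /expR -EFin_lim; last exact: is_cvg_series_exp_coeff.
  by apply/congr_lim/funext => N; rewrite /= sumEFin.
by rewrite -EFinM /= -expRD; congr (expR _)%:E; ring.
Qed.

Section WeightedSum.
Context {R : realType} {d : measure_display} {T : measurableType d}
  {P : probability T R} {n : nat} (Y : 'I_n -> {RV P >-> nat}).

Definition weighted_sum (w : T) : nat := (\sum_(j < n) j.+1 * Y j w)%N.

Lemma measurable_weighted_sum : measurable_fun setT weighted_sum.
Proof.
rewrite /weighted_sum; elim: (index_enum _) => [|j s IH].
  by under eq_fun do rewrite big_nil; exact: measurable_cst.
under eq_fun do rewrite big_cons.
apply: measurable_fun_addn => //.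
by apply: (measurableT_comp (f := muln j.+1) (g := Y j)).
Qed.

HB.instance Definition _ :=
  isMeasurableFun.Build _ _ _ _ weighted_sum measurable_weighted_sum.

Lemma weighted_sum_pgf (r : 'I_n -> R) z : mutually_independent Y ->
  (forall j, 0 < r j) -> (forall j, poisson_distributed (Y j) (r j)) ->
  0 < z < 1 ->
  mean (nat_law P weighted_sum) (fun k => z ^+ k) =
  expR (\sum_(j < n) r j * (z ^+ j.+1 - 1)).
Proof.
move=> indep r0 pois /andP[/ltW z0 /ltW z1].
have z01 k : 0 <= z ^+ k <= 1 by rewrite exprn_ge0//= exprn_ile1.
apply: EFin_inj; rewrite mean_nat_law//.
under eq_integral do rewrite /weighted_sum expr_sum.
under eq_integral do under eq_bigr do rewrite exprM.
rewrite (integral_prod_independentT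
  (F := fun (j : 'I_n) k => (z ^+ j.+1) ^+ k))//.
  rewrite expR_sum; congr (_%:E); apply: eq_bigr => j _.
  by apply: poisson_pgf => // k; apply: EFin_inj; rewrite nat_lawE pois.
by move=> j k; rewrite -exprM.
Qed.

End WeightedSum.

(** * Convergence of the queue length *)

Section QueueLimit.
Context {R : realType} (lambda mu : R) (n : nat) (d : measure_display)
  (T : measurableType d) (P : probability T R) (Q : R -> {RV P >-> nat}).
Hypotheses (la0 : 0 < lambda) (mu0 : 0 < mu) (n0 : (0 < n)%N)
  (ctmcQ : ctmc (batch_queue_generator lambda mu n) Q).

(** The Markov property between the times 0 and t, summed over the initial
    state. *)
Lemma markov_nat_law p t k : markov_with Q p -> 0 < t ->
  (\sum_(0 <= j <oo) (nat_law P (Q 0) j * p t j k)%:E =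
   (nat_law P (Q t) k)%:E)%E.
Proof.
move=> mk t0; rewrite nat_lawE.
rewrite (total_probability (Q 0) (measurable_nat_preimage _ _)).
apply: eq_eseriesr => j _.
pose s i : R := if i is 0%N then 0 else t.
pose x i : nat := if i is 0%N then j else k.
have := mk 0%N s x (lexx 0).
rewrite /s /= subr0 => /(_ _)/wrap[|H]; first by case.
rewrite EFinM nat_lawE; transitivity
  (P [set w | forall i, (i <= 0)%N -> Q (s i) w = x i] * (p t j k)%:E)%E.
  congr (P _ * _)%E; apply/seteqP.
  by split=> [w /= Qw [|//] _|w /(_ 0%N)]; exact.
rewrite -H; congr (P _); apply/seteqP; split=> w /=.
  by move=> Qw; split; [exact: (Qw 1%N)|exact: (Qw 0%N)].
by move=> [Q1 Q0] [|[|//]].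
Qed.

(** Conditionally on Q 0 = i the generating function at time t is a factor that
    is free of i, times w t ^+ i; the average of the latter tends to 1. *)
Lemma queue_pgf_cvg z : 0 < z < 1 ->
  mean (nat_law P (Q t)) (fun k => z ^+ k) @[t --> +oo] -->
  expR (lambda / mu * ((harmonic_poly R n).[z] - (harmonic_poly R n).[1])).
Proof.
move=> z01; have z01' k : 0 <= z ^+ k <= 1.
  by case/andP: z01 => /ltW z0 /ltW z1; rewrite exprn_ge0//= exprn_ile1.
have [p [tp gp mk]] := ctmcQ.
set w := survival_pgf mu z; set H := harmonic_poly R n.
have w01 t : 0 <= t -> 0 <= w t <= 1.
  move=> t0; have /andP[zw ->] := survival_pgf_itv mu0 z01 t0.
  by rewrite andbT (le_trans _ zw)//; case/andP: z01 => /ltW.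
have cw : w t @[t --> +oo] --> (1 : R) by exact: cvg_survival_pgf.
have cH : H.[w t] @[t --> +oo] --> H.[1].
  exact: (cvg_comp _ _ cw (@continuous_horner R H 1)).
have cE : expR (lambda / mu * (H.[z] - H.[w t])) @[t --> +oo] -->
    expR (lambda / mu * (H.[z] - H.[1])).
  have cA : lambda / mu * (H.[z] - H.[w t]) @[t --> +oo] -->
      lambda / mu * (H.[z] - H.[1]).
    by apply: cvgMl_tmp; apply: cvgB => //; exact: cvg_cst.
  exact: (cvg_comp _ _ cA (@continuous_expR R _)).
have cM : mean (nat_law P (Q 0)) (fun k => w t ^+ k) @[t --> +oo] --> (1 : R).
  apply: mean_exp_cvg1 => //; first exact: nat_law_prob_vector.
  by near=> t; apply: w01; near: t; exact: nbhs_pinfty_ge.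
rewrite -[X in _ --> X]mulr1; apply: cvg_trans (cvgM cE cM).
apply: near_eq_cvg; near=> t.
have t0 : 0 < t by near: t; exact: nbhs_pinfty_gt.
rewrite /= -meanZ; first last.
- move=> k; have /andP[? ?] := w01 t (ltW t0).
  by rewrite exprn_ge0//= exprn_ile1.
- exact: nat_law_prob_vector.
rewrite (@mean_mix _ (nat_law P (Q 0)) (nat_law P (Q t)) (p t))//.
- congr mean; apply/funext => j.
  by rewrite (transition_pgf la0 mu0 n0 tp gp _ z01 (ltW t0)).
- exact: nat_law_prob_vector.
- by move=> j; exact: transition_prob_vector (ltW t0).
- by move=> k; exact: markov_nat_law.
Unshelve. all: by end_near. Qed.

Lemma queue_law_cvg (b : nat -> R) : prob_vector b ->
  (forall z, 0 < z < 1 -> mean b (fun k => z ^+ k) =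
    expR (lambda / mu * ((harmonic_poly R n).[z] - (harmonic_poly R n).[1]))) ->
  forall k, nat_law P (Q t) k @[t --> +oo] --> b k.
Proof.
move=> pb bz; apply: cvg_of_pgf => // [t|z z01].
  exact: nat_law_prob_vector.
by rewrite bz//; exact: queue_pgf_cvg.
Qed.

End QueueLimit.

Theorem proposition2p4 (R : realType) (lambda mu : R) (n : nat)
    (lambda_gt0 : 0 < lambda) (mu_gt0 : 0 < mu) (n_gt0 : (0 < n)%N)
    (* the queue length process *)
    (d : measure_display) (T : measurableType d) (P : probability T R)
    (Q : R -> {RV P >-> nat})
    (ctmcQ : ctmc (batch_queue_generator lambda mu n) Q)
    (* Y j stands for the variable of index j + 1 *)
    (d2 : measure_display) (T2 : measurableType d2) (P2 : probability T2 R)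
    (Y : 'I_n -> {RV P2 >-> nat})
    (indepY : mutually_independent Y)
    (poissonY : forall j : 'I_n,
       poisson_distributed (Y j) (lambda / (j.+1%:R * mu))) :
  (exists nu : probability nat R, limiting_distribution Q nu) /\
  (forall (d1 : measure_display) (T1 : measurableType d1)
      (P1 : probability T1 R) (Qinf : {RV P1 >-> nat}),
    limiting_distribution Q (distribution P1 Qinf) ->
    eq_in_distribution P1 P2 Qinf
      (fun w => (\sum_(j < n) j.+1 * Y j w)%N)).
Proof.
pose S : {RV P2 >-> nat} := weighted_sum Y.
have Spgf z : 0 < z < 1 -> mean (nat_law P2 S) (fun k => z ^+ k) =
    expR (lambda / mu * ((harmonic_poly R n).[z] - (harmonic_poly R n).[1])).
  move=> z01; rewrite (weighted_sum_pgf indepY _ poissonY)//; last first.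
    by move=> j; rewrite divr_gt0// mulr_gt0.
  congr expR; rewrite !harmonic_polyE -sumrB mulr_sumr; apply: eq_bigr => j _.
  by rewrite expr1n; field; rewrite nat1r pnatr_eq0 lt0r_neq0.
have limS : limiting_distribution Q (distribution P2 S).
  move=> k.
  have cS : nat_law P (Q t) k @[t --> +oo] --> nat_law P2 S k.
    by apply: queue_law_cvg Spgf k => //; exact: nat_law_prob_vector.
  suff : P (Q t @^-1` [set k]) @[t --> +oo] --> (nat_law P2 S k)%:E.
    by rewrite nat_lawE.
  apply: cvg_EFin; last exact: cS.
  apply: nearW => t.
  by rewrite fin_num_measure//; exact: measurable_nat_preimage.
split=> [|d1 T1 P1 Qinf limQ]; first by exists (distribution P2 S).
apply: (eq_distribution_of_nat_law (X' := S)) => k.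
by congr fine; exact: (cvg_unique (@ereal_hausdorff R) (limQ k) (limS k)).
Qed.
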